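(* Let $f:\mathbb{R}^d\to\mathbb{R}$ be continuously differentiable with $L$-Lipschitz continuous gradient, and let $f^*=\min_{x\in\mathbb{R}^d}f(x)$. Let $\delta_1>0$, $\epsilon_S\in(0,3/4)$, $l\in\mathbb{N}^+$ be such that $$\delta_S<\frac{c}{(c+1)^2},\qquad \left[(1-\delta_S)(1-\delta_1)-1+\frac{c}{(c+1)^2}\right]^{-1}>0,$$ where $\delta_S=e^{-\frac{l(\epsilon_S-1/4)^2}{C_3}}$ and $C_3$ is the stable $1$-hashing embedding constant specified in the context. Apply the random-subspace quadratic regularisation algorithm described in the context to $f$, where $\|B_k\|_2\le B_{\max}$ for all $k$ and some constant $B_{\max}\ge0$, and where $\mathcal S$ is the distribution of $l\times d$ stable $1$-hashing matrices. Let $\epsilon>0$ and suppose the algorithm runs for $N$ iterations with $$N\ \ge\ \left[(1-\delta_S)(1-\delta_1)-1+\frac{c}{(c+1)^2}\right]^{-1}\left[\frac{f(x_0)-f^*}{h(\epsilon,\alpha_0\gamma_1^{c+\tau_\alpha})}+\frac{\tau_\alpha}{1+c}\right],$$ where $$h(\epsilon,\alpha_0\gamma_1^{c+\tau_\alpha})=\frac{\theta(1-\epsilon_S)\epsilon^2}{2\alpha_{\max}}\left(\sqrt{\lceil d/l\rceil}\left(B_{\max}+\alpha_0^{-1}\gamma_1^{-c-\tau_\alpha}\right)+\kappa_T\right)^{-2}$$ and $\tau_\alpha=\left\lceil\log_{\gamma_1}\left(\min\{\alpha_{low}/\alpha_0,\,1/\gamma_2\}\right)\right\rceil$ with $\alpha_{low}=\frac{1-\theta}{L+B_{\max}}$.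 Then $$\mathbb{P}(N\ge N_\epsilon)\ \ge\ 1-e^{-\frac{\delta_1^2}{2}(1-\delta_S)N},$$ where $N_\epsilon=\inf\{M:\min_{k\le M}\|\nabla f(x_k)\|_2\le\epsilon\}$.
   Context: Stable $1$-hashing matrix: for $l<d$ in $\mathbb{N}^+$, a random matrix $S\in\mathbb{R}^{l\times d}$ with exactly one non-zero per column, whose value is $\pm1$ with equal probability (independent signs), the row indices of the non-zeros being given by a sequence $\mathcal I$ constructed as follows: repeat the set $\{1,\dots,l\}$ $\lceil d/l\rceil$ times to obtain a multiset $D$, then randomly sample $d$ elements from $D$ without replacement to form $\mathcal I$. Constant $C_3$: $C_3>0$ is a problem-independent constant for which the $l\times d$ stable $1$-hashing distribution satisfies, for every fixed $y\in\{\nabla f(x):x\in\mathbb{R}^d\}$, $\mathbb{P}\left(\|Sy\|_2^2\ge(1-\epsilon_S)\|y\|_2^2\right)\ge1-e^{-l(\epsilon_S-1/4)^2/C_3}$ (whenever $e^{-l(\epsilon_S-1/4)^2/C_3}\in(0,1/2)$). Random-subspace quadratic regularisation algorithm. Choose a distribution $\mathcal S$ of random matrices in $\mathbb{R}^{l\times d}$, and constants $\gamma_1\in(0,1)$, $\gamma_2=\gamma_1^{-c}$ for some $c\in\mathbb{N}^+$ (positive integers), $\theta\in(0,1)$, $\alpha_{\max}>0$, $\kappa_T\ge0$, a starting point $x_0\in\mathbb{R}^d$, and $\alpha_0=\alpha_{\max}\gamma_1^p$ for some $p\in\mathbb{N}^+$. For $k=0,1,\dots$: (1) Draw $S_k\in\mathbb{R}^{l\times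 d}$ from $\mathcal S$ (independently of all previous iterations) and let $\hat m_k(\hat s)=f(x_k)+\langle S_k\nabla f(x_k),\hat s\rangle+\frac12\langle\hat s,S_kB_kS_k^T\hat s\rangle$, where $B_k\in\mathbb{R}^{d\times d}$ is a user-chosen positive semi-definite matrix ($B_k=0$ is allowed). Compute $\hat s_k\in\mathbb{R}^l$ by approximately minimising $\hat q_k(\hat s)=\hat m_k(\hat s)+\frac{1}{2\alpha_k}\|S_k^T\hat s\|_2^2$ such that $\|\nabla\hat q_k(\hat s_k)\|_2\le\kappa_T\|S_k^T\hat s_k\|_2$ and $\hat q_k(\hat s_k)\le\hat q_k(0)$. Set $s_k=S_k^T\hat s_k$. (2) Check the sufficient decrease condition $f(x_k)-f(x_k+s_k)\ge\theta[\hat m_k(0)-\hat m_k(\hat s_k)]$. (3) If it holds, set $x_{k+1}=x_k+s_k$, $\alpha_{k+1}=\min\{\alpha_{\max},\gamma_2\alpha_k\}$ (successful); otherwise $x_{k+1}=x_k$, $\alpha_{k+1}=\gamma_1\alpha_k$ (unsuccessful). *)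

(* Defs.v *)
From HB Require Import structures.
From mathcomp Require Import all_boot all_order all_algebra.
From mathcomp Require Import all_classical all_reals all_analysis.
Set Implicit Arguments.
Unset Strict Implicit.
Unset Printing Implicit Defensive.
Import Order.TTheory GRing.Theory Num.Theory.
Import numFieldNormedType.Exports.
Local Open Scope classical_set_scope.
Local Open Scope ring_scope.

Section Euclidean.
Context {R : realType}.

Definition dot n (u v : 'cV[R]_n) : R := \sum_(i < n) u i 0 * v i 0.

(* The library norm `|_| on matrices is the sup norm. *)
Definition norm2 n (u : 'cV[R]_n) : R := Num.sqrt (dot u u).

Definition spectral_norm m n (A : 'M[R]_(m, n)) : R :=
  sup [set norm2 (A *m v) | v in [set v : 'cV[R]_n | norm2 v <= 1]].

Definition psd_mx n (A : 'M[R]_n) : Prop :=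
  A^T = A /\ forall v : 'cV[R]_n, 0 <= dot v (A *m v).

Definition grad n (f : 'cV[R]_n -> R) (x : 'cV[R]_n) : 'cV[R]_n :=
  \col_j 'D_(delta_mx j 0) f x.

Definition continuously_differentiable n (f : 'cV[R]_n -> R) : Prop :=
  (forall x, differentiable f x) /\ continuous (grad f).

Definition lipschitz_gradient n (f : 'cV[R]_n -> R) (L : R) : Prop :=
  forall x y, norm2 (grad f x - grad f y) <= L * norm2 (x - y).

End Euclidean.

Definition ceil_div (d l : nat) : nat := `|Num.ceil (d%:R / l%:R : rat)|%N.

(* The multiset D is the type of pairs (i, r), the r-th copy of the row index i;
   drawing d elements from it without replacement is drawing w.1 uniformly among
   the injective maps.  The bit w.2 j gives the sign of the entry in column j. *)
Definition hash_seed (l d : nat) : finType :=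
  ({ffun 'I_d -> 'I_l * 'I_(ceil_div d l)} * {ffun 'I_d -> bool})%type.

Section Hashing.
Context {R : realType}.

Definition hash_mx l d (w : hash_seed l d) : 'M[R]_(l, d) :=
  \matrix_(i < l, j < d) if i == (w.1 j).1 then (-1) ^+ w.2 j else 0.

Definition stable_1_hashing l d (E : set 'M[R]_(l, d)) : R :=
  #|[pred w : hash_seed l d | injectiveb w.1 & `[< E (hash_mx w) >]]|%:R
  / #|[pred w : hash_seed l d | injectiveb w.1]|%:R.

Definition delta_S (l : nat) (epsS C3 : R) : R :=
  expR (- (l%:R * (epsS - 4^-1) ^+ 2 / C3)).

Definition embedding_constant d (f : 'cV[R]_d -> R) (l : nat) (epsS C3 : R) :
    Prop :=
  0 < delta_S l epsS C3 < 2^-1 ->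
  forall x : 'cV[R]_d, let y := grad f x in
  1 - delta_S l epsS C3 <=
  stable_1_hashing
    [set S : 'M[R]_(l, d) | norm2 (S *m y) ^+ 2 >= (1 - epsS) * norm2 y ^+ 2].

End Hashing.

Section Algorithm.
Context {R : realType} (l d : nat) (f : 'cV[R]_d -> R).

Definition mhat (x : 'cV[R]_d) (S : 'M[R]_(l, d)) (B : 'M[R]_d)
    (s : 'cV[R]_l) : R :=
  f x + dot (S *m grad f x) s + 2^-1 * dot s (S *m B *m S^T *m s).

Definition qhat (x : 'cV[R]_d) (S : 'M[R]_(l, d)) (B : 'M[R]_d) (alpha : R)
    (s : 'cV[R]_l) : R :=
  mhat x S B s + (2 * alpha)^-1 * norm2 (S^T *m s) ^+ 2.

Definition sufficient_decrease (theta : R) (x : 'cV[R]_d) (S : 'M[R]_(l, d))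
    (B : 'M[R]_d) (s : 'cV[R]_l) : bool :=
  f x - f (x + S^T *m s) >= theta * (mhat x S B 0 - mhat x S B s).

Record qr_trajectory (gamma1 theta alphamax kappaT : R) (c p : nat)
    (x0 : 'cV[R]_d) (S : nat -> 'M[R]_(l, d)) (B : nat -> 'M[R]_d)
    (s : nat -> 'cV[R]_l) (x : nat -> 'cV[R]_d) (alpha : nat -> R) : Prop := {
  qr_x0 : x 0%N = x0;
  qr_alpha0 : alpha 0%N = alphamax * gamma1 ^+ p;
  qr_psd : forall k, psd_mx (B k);
  qr_stationary : forall k,
    norm2 (grad (qhat (x k) (S k) (B k) (alpha k)) (s k))
    <= kappaT * norm2 ((S k)^T *m s k);
  qr_decrease : forall k,
    qhat (x k) (S k) (B k) (alpha k) (s k)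
    <= qhat (x k) (S k) (B k) (alpha k) 0;
  qr_success : forall k,
    sufficient_decrease theta (x k) (S k) (B k) (s k) ->
    x k.+1 = x k + (S k)^T *m s k /\
    alpha k.+1 = Num.min alphamax (gamma1 ^- c * alpha k);
  qr_failure : forall k,
    ~~ sufficient_decrease theta (x k) (S k) (B k) (s k) ->
    x k.+1 = x k /\ alpha k.+1 = gamma1 * alpha k
}.

Definition N_eps (eps : R) (x : nat -> 'cV[R]_d) : \bar R :=
  ereal_inf [set (M%:R)%:E | M in [set M : nat |
    \big[Num.min/norm2 (grad f (x 0%N))]_(k < M.+1) norm2 (grad f (x k)) <= eps]].

End Algorithm.

Section Randomness.
Context {R : realType} (dO : measure_display) (Omega : measurableType dO).

Definition borel (T : topologicalType) : set (set T) := <<s [set U | open U] >>.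

Definition random_element (T : topologicalType) (X : Omega -> T) : Prop :=
  forall E, borel E -> measurable (X @^-1` E).

Definition events_before (T : topologicalType) (X : nat -> Omega -> T)
    (k : nat) : set (set Omega) :=
  [set A | exists2 i, (i < k)%N & exists2 E, borel E & A = X i @^-1` E].

(* The sigma-algebra of everything known when S_k is drawn: iterations
   0, ..., k-1, including the iterate x_k and parameter alpha_k they output. *)
Definition history l d (S : nat -> Omega -> 'M[R]_(l, d))
    (B : nat -> Omega -> 'M[R]_d) (s : nat -> Omega -> 'cV[R]_l)
    (x : nat -> Omega -> 'cV[R]_d) (alpha : nat -> Omega -> R) (k : nat) :
    set (set Omega) :=
  <<s events_before x k.+1 `|` events_before alpha k.+1
      `|` events_before S k `|` events_before B k `|` events_before s k >>.

Record random_qr_run (P : probability Omega R) l d (f : 'cV[R]_d -> R)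
    (gamma1 theta alphamax kappaT : R) (c p : nat) (x0 : 'cV[R]_d)
    (S : nat -> Omega -> 'M[R]_(l, d)) (B : nat -> Omega -> 'M[R]_d)
    (s : nat -> Omega -> 'cV[R]_l) (x : nat -> Omega -> 'cV[R]_d)
    (alpha : nat -> Omega -> R) : Prop := {
  run_S : forall k, random_element (S k);
  run_B : forall k, random_element (B k);
  run_s : forall k, random_element (s k);
  run_x : forall k, random_element (x k);
  run_alpha : forall k, random_element (alpha k);
  run_law : forall k E, borel E ->
    P (S k @^-1` E) = (stable_1_hashing E)%:E;
  run_indep : forall k A E, history S B s x alpha k A -> borel E ->
    P (A `&` S k @^-1` E) = (P A * P (S k @^-1` E))%E;
  run_trajectory : forall w : Omega,
    qr_trajectory f gamma1 theta alphamax kappaT c p x0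
      (S ^~ w) (B ^~ w) (s ^~ w) (x ^~ w) (alpha ^~ w)
}.

End Randomness.

Section Constants.
Context {R : realType}.

Definition alpha_low (theta L Bmax : R) : R := (1 - theta) / (L + Bmax).

Definition tau_alpha (gamma1 theta L Bmax alpha0 : R) (c : nat) : int :=
  Num.ceil (ln (Num.min (alpha_low theta L Bmax / alpha0) (1 / gamma1 ^- c))
            / ln gamma1).

Definition h (l d : nat) (theta epsS alphamax Bmax kappaT eps a : R) : R :=
  theta * (1 - epsS) * eps ^+ 2 / (2 * alphamax)
  * (Num.sqrt (ceil_div d l)%:R * (Bmax + a^-1) + kappaT) ^- 2.

End Constants.

(* Main.v *)
Require Import Defs.
From mathcomp Require Import all_boot all_order all_algebra.
From mathcomp Require Import all_classical all_reals all_analysis.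
From mathcomp Require Import ring lra.
Import Order.TTheory GRing.Theory Num.Theory.
Import numFieldNormedType.Exports.
Set Implicit Arguments.
Unset Strict Implicit.
Unset Printing Implicit Defensive.
Local Open Scope classical_set_scope.
Local Open Scope ring_scope.

(** Call iteration k true when S_k is a hashing matrix that keeps the fraction
    1 - epsS of the squared norm of the gradient at x_k. A hashing matrix has at most
    ceil_div d l non-zeros per row and one per column, so its norm is at most the
    square root of this number (norm2_hash_mx).

    Fix a trajectory whose gradients stay above eps in norm. By the descent lemma, a
    step with alpha_k <= alpha_low is successful (small_alpha_success); hence the
    stepsize stays above alpha0 * gamma1 ^ (tau + 1). A failure multiplies it by
    gamma1 and a success by at most gamma1 ^ (-c), so that
    failures <= tau + c * successes, and at most (tau + c N) / (1 + c) of the first N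
    iterations fail. A true success decreases f by at least h, because approximate
    stationarity bounds the step below by a multiple of the sketched gradient
    (true_success_decrease); there are at most (f x0 - fstar) / h of these. Adding up
    (true_iterations_le), the number of true iterations is at most

      c / (c + 1) N + (f x0 - fstar) / h + tau / (1 + c).

    The iterate x_k is random, but which seeds give a good sketch at x_k is a
    finite-valued function of the past, and S_k is independent of the past; so, given
    the past, iteration k is true with probability at least 1 - deltaS
    (true_iteration_probability). A Chernoff argument for such dependent trials
    (chernoff_lower_tail) shows that, except with probability
    exp (- delta1 ^ 2 (1 - deltaS) N / 2), at least (1 - deltaS) (1 - delta1) N of the
    first N iterations are true. The assumption on N says that this number is at least

      (1 - c / (c + 1) ^ 2) N + (f x0 - fstar) / h + tau / (1 + c),

    and c / (c + 1) < 1 - c / (c + 1) ^ 2, so the two bounds contradict each other when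
    N > 0. For N = 0 the claimed lower bound on the probability is 0. *)

(** * Euclidean norm and hashing matrices *)

Section Euclidean.
Context {R : realType}.

Lemma dotC n (u v : 'cV[R]_n) : dot u v = dot v u.
Proof. by apply: eq_bigr => i _; rewrite mulrC. Qed.

Lemma dotDl n (u v w : 'cV[R]_n) : dot (u + v) w = dot u w + dot v w.
Proof. by rewrite -big_split; apply: eq_bigr => i _; rewrite mxE mulrDl. Qed.

Lemma dotDr n (u v w : 'cV[R]_n) : dot u (v + w) = dot u v + dot u w.
Proof. by rewrite dotC dotDl !(dotC u). Qed.

Lemma dotZl n a (u v : 'cV[R]_n) : dot (a *: u) v = a * dot u v.
Proof. by rewrite mulr_sumr; apply: eq_bigr => i _; rewrite mxE mulrA. Qed.

Lemma dotZr n a (u v : 'cV[R]_n) : dot u (a *: v) = a * dot u v.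
Proof. by rewrite dotC dotZl dotC. Qed.

Lemma dotNl n (u v : 'cV[R]_n) : dot (- u) v = - dot u v.
Proof. by rewrite -scaleN1r dotZl mulN1r. Qed.

Lemma dotBl n (u v w : 'cV[R]_n) : dot (u - v) w = dot u w - dot v w.
Proof. by rewrite dotDl dotNl. Qed.

Lemma dot0r n (u : 'cV[R]_n) : dot u 0 = 0.
Proof. by rewrite -(scale0r 0) dotZr mul0r. Qed.

Lemma dot_mulmx m n (A : 'M[R]_(m, n)) (u : 'cV[R]_n) (v : 'cV[R]_m) :
  dot (A *m u) v = dot u (A^T *m v).
Proof.
rewrite /dot; under eq_bigr do rewrite mxE mulr_suml.
rewrite exchange_big; apply: eq_bigr => j _; rewrite mxE mulr_sumr.
by apply: eq_bigr => i _; rewrite !mxE; ring.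
Qed.

Lemma dot_delta n (u : 'cV[R]_n) j : dot u (delta_mx j 0) = u j 0.
Proof.
rewrite /dot (bigD1 j)//= mxE !eqxx mulr1 big1 ?addr0// => i ij.
by rewrite mxE (negPf ij) mulr0.
Qed.

Lemma dot_ge0 n (u : 'cV[R]_n) : 0 <= dot u u.
Proof. by apply: sumr_ge0 => i _; rewrite -expr2 sqr_ge0. Qed.

Lemma norm2_ge0 n (u : 'cV[R]_n) : 0 <= norm2 u.
Proof. exact: sqrtr_ge0. Qed.

Lemma norm2_sqr n (u : 'cV[R]_n) : norm2 u ^+ 2 = dot u u.
Proof. by rewrite sqr_sqrtr// dot_ge0. Qed.

Lemma norm2Z n a (u : 'cV[R]_n) : norm2 (a *: u) = `|a| * norm2 u.
Proof. by rewrite /norm2 dotZl dotZr mulrA -expr2 sqrtrM ?sqr_ge0// sqrtr_sqr. Qed.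

Lemma norm2N n (u : 'cV[R]_n) : norm2 (- u) = norm2 u.
Proof. by rewrite -scaleN1r norm2Z normrN1 mul1r. Qed.

Lemma norm2_eq0 n (u : 'cV[R]_n) : norm2 u = 0 -> u = 0.
Proof.
move=> u0; have : dot u u = 0 by rewrite -norm2_sqr u0 expr0n.
move=> /psumr_eq0P h; apply/colP => i; rewrite mxE.
have /eqP := h (fun i _ => sqr_ge0 (u i 0)) i isT.
by rewrite mulf_eq0 orbb => /eqP.
Qed.

(** Expand the square of |v| u - |u| v. *)
Lemma cauchy_schwarz n (u v : 'cV[R]_n) : dot u v <= norm2 u * norm2 v.
Proof.
have [u0|u0] := eqVneq (norm2 u) 0.
  by rewrite u0 mul0r (norm2_eq0 u0) dotC dot0r.
have [v0|v0] := eqVneq (norm2 v) 0.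
  by rewrite v0 mulr0 (norm2_eq0 v0) dot0r.
have uvgt0 : 0 < norm2 u * norm2 v.
  by rewrite mulr_gt0// lt0r ?u0 ?v0 norm2_ge0.
have := dot_ge0 (norm2 v *: u - norm2 u *: v).
rewrite -scaleNr !(dotDl, dotDr, dotZl, dotZr) (dotC v u) -!norm2_sqr => h.
by rewrite -subr_ge0 -(pmulr_rge0 _ uvgt0); lra.
Qed.

Lemma cauchy_schwarz_sqr n (u v : 'cV[R]_n) :
  dot u v ^+ 2 <= dot u u * dot v v.
Proof.
rewrite -!norm2_sqr -exprMn -[leLHS]real_normK ?num_real//.
rewrite ler_pXn2r ?nnegrE ?mulr_ge0 ?norm2_ge0// ler_norml cauchy_schwarz andbT.
by rewrite lerNl -dotNl -(norm2N u) cauchy_schwarz.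
Qed.

Lemma norm2D n (u v : 'cV[R]_n) : norm2 (u + v) <= norm2 u + norm2 v.
Proof.
rewrite -(@ler_pXn2r _ 2)// ?nnegrE ?addr_ge0 ?norm2_ge0//.
rewrite norm2_sqr dotDl !dotDr (dotC v u) sqrrD -!norm2_sqr.
by have := cauchy_schwarz u v; lra.
Qed.


Lemma norm2_mulmx m n (A : 'M[R]_(m, n)) (v : 'cV[R]_n) :
  norm2 (A *m v) <= spectral_norm A * norm2 v.
Proof.
have ubA : has_ubound [set norm2 (A *m v) | v in [set v : 'cV[R]_n | norm2 v <= 1]].
  exists (Num.sqrt (\sum_i dot (row i A)^T (row i A)^T)) => _ [u /= u1 <-].
  rewrite ler_wsqrtr//; apply: ler_sum => i _.
  have -> : (A *m u) i 0 * (A *m u) i 0 = dot (row i A)^T u ^+ 2.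
    by rewrite expr2 mxE; congr (_ * _); apply: eq_bigr => j _; rewrite !mxE.
  apply: (le_trans (cauchy_schwarz_sqr _ _)).
  by rewrite ler_piMr ?dot_ge0// -norm2_sqr expr_le1// norm2_ge0.
have [v0|v0] := eqVneq (norm2 v) 0.
  by rewrite (norm2_eq0 v0) mulmx0 /norm2 !dot0r sqrtr0 mulr0.
have vgt0 : 0 < norm2 v by rewrite lt0r v0 norm2_ge0.
rewrite -ler_pdivrMr// mulrC -[X in X * _]ger0_norm ?invr_ge0 ?norm2_ge0//.
rewrite -norm2Z scalemxAr; apply: ub_le_sup => //=; exists ((norm2 v)^-1 *: v) => //=.
by rewrite norm2Z ger0_norm ?invr_ge0 ?norm2_ge0// mulVf.
Qed.

(** Columns that draw the same row index draw distinct copies of it. *)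
Lemma card_hash_row l d (w : hash_seed l d) (i : 'I_l) :
  injective w.1 -> (#|[pred j | (w.1 j).1 == i]| <= ceil_div d l)%N.
Proof.
move=> winj; rewrite -[leqRHS]card_ord.
rewrite -(card_in_image (f := fun j => (w.1 j).2)); first exact: max_card.
move=> j k /eqP ji /eqP ki jk; apply: winj.
by rewrite [LHS]surjective_pairing [RHS]surjective_pairing ji ki jk.
Qed.

(** Row by row, Cauchy-Schwarz against the indicator of the support of the row costs
    the size of this support; the supports partition the columns. *)
Lemma norm2_hash_mx l d (w : hash_seed l d) (v : 'cV[R]_d) :
  injective w.1 ->
  norm2 (hash_mx w *m v) <= Num.sqrt (ceil_div d l)%:R * norm2 v.
Proof.
move=> winj; rewrite -(@ler_pXn2r _ 2) ?nnegrE ?mulr_ge0 ?sqrtr_ge0 ?norm2_ge0//.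
rewrite exprMn !norm2_sqr sqr_sqrtr ?ler0n// {2}/dot.
have -> : \sum_j v j 0 * v j 0 = \sum_i \sum_(j | (w.1 j).1 == i) v j 0 ^+ 2.
  by rewrite (partition_big (fun j => (w.1 j).1) xpredT).
rewrite mulr_sumr; apply: ler_sum => i _.
pose a : 'cV[R]_d := \col_j ((w.1 j).1 == i)%:R.
pose b : 'cV[R]_d := \col_j (if (w.1 j).1 == i then (-1) ^+ w.2 j * v j 0 else 0).
have -> : (hash_mx w *m v) i 0 = dot a b.
  rewrite mxE; apply: eq_bigr => j _; rewrite !mxE eq_sym.
  by case: eqP => _; rewrite ?mul1r ?mul0r.
rewrite -expr2; apply: (le_trans (cauchy_schwarz_sqr _ _)).
have -> : dot b b = \sum_(j | (w.1 j).1 == i) v j 0 ^+ 2.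
  rewrite [RHS]big_mkcond; apply: eq_bigr => j _; rewrite mxE.
  by case: eqP => _; rewrite ?mulr0// -expr2 exprMn sqrr_sign mul1r.
rewrite ler_wpM2r ?sumr_ge0// => [j _|]; first exact: sqr_ge0.
have -> : dot a a = #|[pred j | (w.1 j).1 == i]|%:R.
  rewrite -sum1_card natr_sum [RHS]big_mkcond; apply: eq_bigr => j _.
  by rewrite mxE inE; case: eqP => _; rewrite ?mulr0 ?mulr1.
by rewrite ler_nat card_hash_row.
Qed.

End Euclidean.

(** * Gradients along lines *)

Section Calculus.
Context {R : realType}.

(** Along a line the difference quotient is the slope plus a multiple of the step. *)
Lemma grad_quadratic n (a : R) (b : 'cV[R]_n) (H : 'M[R]_n) (u : 'cV[R]_n) :
  H^T = H ->
  grad (fun s => a + dot b s + 2^-1 * dot s (H *m s)) u = b + H *m u.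
Proof.
move=> Hsym; apply/colP => j; rewrite mxE -dot_delta.
set v := delta_mx j 0.
pose q (s : 'cV[R]_n) := a + dot b s + 2^-1 * dot s (H *m s).
rewrite -/q.
rewrite /derive; apply: cvg_lim => //.
have -> : dot (b + H *m u) v = dot (b + H *m u) v + 0 * (2^-1 * dot v (H *m v)).
  by rewrite mul0r addr0.
apply: (@cvg_trans _ ((fun h : R => dot (b + H *m u) v
    + h * (2^-1 * dot v (H *m v))) @ 0^')).
  apply: near_eq_cvg; near=> h.
  have h0 : h != 0 by near: h; exact: nbhs_dnbhs_neq.
  rewrite /q /= mulmxDr -scalemxAr !(dotDl, dotDr, dotZl, dotZr) /=.
  have -> : dot u (H *m v) = dot (H *m u) v by rewrite dot_mulmx Hsym.
  rewrite (dotC v (H *m u)) /GRing.scale/=.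
  by field.
apply: cvgD; first exact: cvg_cst.
apply: cvgM; last exact: cvg_cst.
by apply: cvg_within_filter; exact: cvg_id.
Unshelve. all: by end_near. Qed.

Lemma derive_dot_grad n (f : 'cV[R]_n -> R) (x v : 'cV[R]_n) :
  differentiable f x -> 'D_v f x = dot (grad f x) v.
Proof.
move=> fx; rewrite deriveE// [in LHS](matrix_sum_delta v) linear_sum.
apply: eq_bigr => i _; rewrite big_ord1 linearZ mxE mulrC.
by rewrite -deriveE.
Qed.

Lemma is_derive_line n (f : 'cV[R]_n -> R) (x v : 'cV[R]_n) (t : R) :
  differentiable f (x + t *: v) ->
  is_derive t 1 (fun r : R => f (x + r *: v)) (dot (grad f (x + t *: v)) v).
Proof.
move=> fx; have dfx : derivable f (x + t *: v) v by exact: diff_derivable.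
have E : (fun h : R => h^-1 *: (f (x + (h *: (1 : R) + t) *: v) - f (x + t *: v)))
    = (fun h => h^-1 *: (f (h *: v + (x + t *: v)) - f (x + t *: v))).
  apply/funext => h; congr (_ *: (f _ - _)).
  by rewrite scalerDl addrCA /GRing.scale/= mulr1.
apply: DeriveDef; first by rewrite /derivable/= E.
by rewrite -derive_dot_grad// /derive/= E.
Qed.

(** The Lipschitz bound makes the derivative of f minus the quadratic model
    non-positive on the segment, so the mean value theorem applies. *)
Lemma lipschitz_gradient_upper_bound n (f : 'cV[R]_n -> R) (L : R)
    (x v : 'cV[R]_n) :
  (forall y, differentiable f y) -> lipschitz_gradient f L ->
  f (x + v) <= f x + dot (grad f x) v + L / 2 * norm2 v ^+ 2.
Proof.
move=> fdiff fL.
pose g (t : R) := f (x + t *: v)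
  - (t * dot (grad f x) v + t ^+ 2 * (L / 2 * norm2 v ^+ 2)).
pose dg (t : R) := dot (grad f (x + t *: v)) v
  - (dot (grad f x) v + t * (L * norm2 v ^+ 2)).
have gdg (t : R) : is_derive t 1 g (dg t).
  apply: is_deriveB; first exact: is_derive_line.
  apply: is_derive_eq.
  rewrite /GRing.scale/=; lra.
have [|c] := @MVT R g dg 0 1 ltr01.
  by apply: derivable_within_continuous => r _.
rewrite in_itv/= => /andP[c0 c1] gE.
have dgc : dg c <= 0.
  rewrite /dg opprD addrA subr_le0 -dotBl.
  apply: (le_trans (cauchy_schwarz _ _)).
  apply: (@le_trans _ _ (L * norm2 (c *: v) * norm2 v)).
    rewrite ler_wpM2r ?norm2_ge0//.
    by have := fL (x + c *: v) x; rewrite addrAC subrr add0r.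
  by rewrite norm2Z gtr0_norm//; lra.
move: gE; rewrite /g scale1r scale0r addr0; lra.
Qed.

End Calculus.

(** * One iteration *)

Section Step.
Context {R : realType} (l d : nat) (f : 'cV[R]_d -> R).
Context (x : 'cV[R]_d) (S : 'M[R]_(l, d)) (B : 'M[R]_d) (alpha : R)
  (s : 'cV[R]_l).
Hypothesis alpha_gt0 : 0 < alpha.
Hypothesis B_psd : psd_mx B.
Hypothesis q_decrease : qhat f x S B alpha s <= qhat f x S B alpha 0.

Lemma grad_qhat :
  grad (qhat f x S B alpha) s
  = S *m grad f x + S *m (B *m (S^T *m s) + alpha^-1 *: (S^T *m s)).
Proof.
pose H := S *m B *m S^T + alpha^-1 *: (S *m S^T).
have -> : qhat f x S B alpha
    = fun u => f x + dot (S *m grad f x) u + 2^-1 * dot u (H *m u).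
  apply/funext => u; rewrite /qhat /mhat -!addrA; congr (_ + (_ + _)).
  rewrite norm2_sqr dot_mulmx trmxK /H mulmxDl -scalemxAl dotDr dotZr !mulmxA.
  by rewrite invfM; ring.
rewrite grad_quadratic.
  by rewrite /H mulmxDl mulmxDr -scalemxAl -scalemxAr !mulmxA.
by rewrite /H linearD linearZ /= !trmx_mul !trmxK B_psd.1 mulmxA.
Qed.

Lemma model_decrease :
  (2 * alpha)^-1 * norm2 (S^T *m s) ^+ 2 <= mhat f x S B 0 - mhat f x S B s.
Proof.
move: q_decrease; rewrite /qhat mulmx0 /norm2 dot0r sqrtr0 expr0n mulr0 addr0; lra.
Qed.

Lemma model_decrease_ge0 : 0 <= mhat f x S B 0 - mhat f x S B s.
Proof.
apply: le_trans model_decrease.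
by rewrite mulr_ge0 ?sqr_ge0// invr_ge0 mulr_ge0// ltW.
Qed.

(** The Taylor error is at most L |S^T s|^2 / 2, while the regularisation makes the
    model decrease by at least |S^T s|^2 / (2 alpha); the curvature term of the
    model only helps because B is positive semi-definite. *)
Lemma small_alpha_success (theta L : R) :
  0 < theta < 1 -> (forall y, differentiable f y) -> lipschitz_gradient f L ->
  L * alpha <= 1 - theta -> sufficient_decrease f theta x S B s.
Proof.
move=> /andP[theta0 theta1] fdiff fL aL; rewrite /sufficient_decrease.
have := lipschitz_gradient_upper_bound x (S^T *m s) fdiff fL.
have := model_decrease; have := B_psd.2 (S^T *m s).
have m0 : mhat f x S B 0 = f x by rewrite /mhat !dot0r mulmx0 dot0r mulr0 !addr0.
have ms : mhat f x S B s = f x + dot (grad f x) (S^T *m s)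
    + 2^-1 * dot (S^T *m s) (B *m (S^T *m s)).
  by rewrite /mhat -!mulmxA dot_mulmx (dotC s) dot_mulmx (dotC (B *m _)).
rewrite m0 ms; move: (dot _ (B *m _)) (dot _ (S^T *m s)) (f _) => b g fv b0.
have n0 := sqr_ge0 (norm2 (S^T *m s)); move: (_ ^+ 2) n0 => n n0 dec taylor.
have : L / 2 * n <= (1 - theta) * ((2 * alpha)^-1 * n).
  have -> : (1 - theta) * ((2 * alpha)^-1 * n) = (1 - theta) / alpha / 2 * n.
    by rewrite invfM; ring.
  by rewrite ler_wpM2r// ler_pM2r ?invr_gt0// ler_pdivlMr.
have : (1 - theta) * ((2 * alpha)^-1 * n)
    <= (1 - theta) * (f x - (f x + g + 2^-1 * b)).
  by rewrite ler_wpM2l//; lra.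
lra.
Qed.

Hypothesis Bmax : R.
Hypothesis B_le : spectral_norm B <= Bmax.

(** By approximate stationarity the sketched gradient is, up to kappa |S^T s|, the
    image under S of (B + 1 / alpha) S^T s. *)
Lemma sketched_grad_le_step (sigma kappa : R) :
  (forall v, norm2 (S *m v) <= sigma * norm2 v) -> 0 <= sigma ->
  norm2 (grad (qhat f x S B alpha) s) <= kappa * norm2 (S^T *m s) ->
  norm2 (S *m grad f x)
  <= (sigma * (Bmax + alpha^-1) + kappa) * norm2 (S^T *m s).
Proof.
move=> S_le sigma0; rewrite grad_qhat.
set g := S *m grad f x; set v := S^T *m s; set w := B *m v + _ => stat.
have w_le : norm2 w <= (Bmax + alpha^-1) * norm2 v.
  apply: (le_trans (norm2D _ _)); rewrite mulrDl lerD//.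
    by apply: (le_trans (norm2_mulmx _ _)); rewrite ler_wpM2r ?norm2_ge0.
  by rewrite norm2Z gtr0_norm ?invr_gt0.
have : norm2 g <= norm2 (g + S *m w) + norm2 (S *m w).
  by have := norm2D (g + S *m w) (- (S *m w)); rewrite addrK norm2N.
have := S_le w; have := ler_wpM2l sigma0 w_le; lra.
Qed.

(** The decrease of f is at least theta |S^T s|^2 / (2 alphamax), and the norm of
    S^T s is at least that of the sketched gradient divided by K below. *)
Lemma true_success_decrease (theta epsS alphamax kappa eps a : R) :
  (0 < ceil_div d l)%N ->
  (forall v, norm2 (S *m v) <= Num.sqrt (ceil_div d l)%:R * norm2 v) ->
  norm2 (grad (qhat f x S B alpha) s) <= kappa * norm2 (S^T *m s) ->
  0 < theta -> epsS < 1 -> 0 <= kappa -> 0 <= Bmax -> 0 <= eps ->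
  0 < a -> a <= alpha -> alpha <= alphamax ->
  (1 - epsS) * norm2 (grad f x) ^+ 2 <= norm2 (S *m grad f x) ^+ 2 ->
  eps <= norm2 (grad f x) ->
  sufficient_decrease f theta x S B s ->
  h l d theta epsS alphamax Bmax kappa eps a <= f x - f (x + S^T *m s).
Proof.
move=> cd0 S_le stat theta0 epsS1 kappa0 Bmax0 eps0 a0 aalpha alphamx Strue epsg.
rewrite /sufficient_decrease; apply: le_trans.
apply: (@le_trans _ _ (theta * ((2 * alpha)^-1 * norm2 (S^T *m s) ^+ 2))); last first.
  by rewrite ler_pM2l// model_decrease.
have := sketched_grad_le_step S_le (sqrtr_ge0 _) stat.
set sigma := Num.sqrt _; set v := norm2 (S^T *m s) => g_le.
have sigma0 : 0 < sigma by rewrite sqrtr_gt0 ltr0n.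
rewrite /h -/sigma; set K := sigma * (Bmax + a^-1) + kappa.
have a1 : alpha^-1 <= a^-1 by rewrite lef_pV2.
have K0 : 0 < K.
  by rewrite /K ltr_wpDr// mulr_gt0// ltr_wpDl// invr_gt0.
have {}g_le : norm2 (S *m grad f x) <= K * v.
  apply: (le_trans g_le); rewrite ler_wpM2r ?norm2_ge0// lerD2r ler_pM2l//.
  by rewrite lerD2l.
have vK : (1 - epsS) * eps ^+ 2 * K ^- 2 <= v ^+ 2.
  rewrite ler_pdivrMr ?exprn_gt0// [leRHS]mulrC -exprMn.
  apply: (@le_trans _ _ ((1 - epsS) * norm2 (grad f x) ^+ 2)).
    by rewrite ler_pM2l ?subr_gt0// ler_pXn2r ?nnegrE ?norm2_ge0.
  apply: (le_trans Strue).
  by rewrite ler_pXn2r ?nnegrE ?mulr_ge0 ?norm2_ge0// ltW.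
have -> : theta * (1 - epsS) * eps ^+ 2 / (2 * alphamax) * K ^- 2
    = theta * ((2 * alphamax)^-1 * ((1 - epsS) * eps ^+ 2 * K ^- 2)) by ring.
rewrite ler_pM2l//.
have amax0 : 0 < alphamax by exact: lt_le_trans alphamx.
have K2 : 0 <= (1 - epsS) * eps ^+ 2 * K ^- 2.
  by rewrite !mulr_ge0 ?sqr_ge0 ?invr_ge0 ?sqr_ge0// subr_ge0 ltW.
apply: ler_pM => //; first by rewrite invr_ge0 mulr_ge0// ltW.
by rewrite lef_pV2 ?posrE ?mulr_gt0// ler_pM2l.
Qed.

End Step.

(** * Counting iterations along a trajectory *)

Section Trajectory.
Context {R : realType} (l d : nat) (f : 'cV[R]_d -> R).
Context (gamma1 theta alphamax kappaT : R) (c p : nat) (x0 : 'cV[R]_d).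
Context (S : nat -> 'M[R]_(l, d)) (B : nat -> 'M[R]_d) (s : nat -> 'cV[R]_l)
  (x : nat -> 'cV[R]_d) (alpha : nat -> R).
Hypothesis traj : qr_trajectory f gamma1 theta alphamax kappaT c p x0 S B s x alpha.
Hypothesis gamma1_01 : 0 < gamma1 < 1.
Hypothesis theta_ge0 : 0 <= theta.
Hypothesis alphamax_gt0 : 0 < alphamax.

Local Notation success k := (sufficient_decrease f theta (x k) (S k) (B k) (s k)).
Local Notation nS k := (\sum_(i < k) success i)%N.
Local Notation nU k := (\sum_(i < k) ~~ success i)%N.
Local Notation alpha0 := (alphamax * gamma1 ^+ p).

Let gamma1_gt0 : 0 < gamma1. Proof. by case/andP: gamma1_01. Qed.
Let gamma1_le1 : gamma1 <= 1. Proof. by case/andP: gamma1_01 => _ /ltW. Qed.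
Let alpha0_gt0 : 0 < alpha0. Proof. by rewrite mulr_gt0// exprn_gt0. Qed.

Lemma alpha_bounds k : 0 < alpha k <= alphamax.
Proof.
elim: k => [|k /andP[a0 amax]].
  rewrite (qr_alpha0 traj) alpha0_gt0/=.
  by apply: ler_piMr; rewrite ?exprn_ile1 ?(ltW alphamax_gt0) ?(ltW gamma1_gt0).
have [sk|sk] := boolP (success k).
  have [_ ->] := qr_success traj sk.
  by rewrite lt_min alphamax_gt0 mulr_gt0 ?invr_gt0 ?exprn_gt0//= ge_min lexx.
have [_ ->] := qr_failure traj sk.
by rewrite mulr_gt0//= (le_trans _ amax)// ler_piMl// ltW.
Qed.

Lemma alpha_upper k : alpha k * gamma1 ^+ (c * nS k) <= alpha0 * gamma1 ^+ nU k.
Proof.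
elim: k => [|k IH].
  by rewrite !big_ord0 muln0 expr0 !mulr1 (qr_alpha0 traj).
rewrite !big_ord_recr/=; have [sk|sk] := boolP (success k).
  have [_ ->] := qr_success traj sk.
  rewrite mulnDr muln1 addn0 exprD mulrA (le_trans _ IH)//.
  rewrite mulrAC ler_wpM2r ?exprn_ge0 ?(ltW gamma1_gt0)//.
  rewrite (@le_trans _ _ (gamma1 ^- c * alpha k * gamma1 ^+ c))//.
    by rewrite ler_wpM2r ?exprn_ge0 ?(ltW gamma1_gt0)// ge_min lexx orbT.
  by rewrite mulrC mulrA divff ?mul1r// expf_neq0// gt_eqF.
have [_ ->] := qr_failure traj sk.
by rewrite addn0 exprD mulrA [leRHS]mulrC -mulrA ler_pM2l.
Qed.

(** A failure needs a stepsize above the threshold and multiplies it by gamma1; a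
    success never decreases it. *)
Lemma alpha_lower (t : nat) :
  (forall k, alpha k <= alpha0 * gamma1 ^+ t -> success k) ->
  forall k, alpha0 * gamma1 ^+ t.+1 < alpha k.
Proof.
move=> ht; elim=> [|k IH].
  rewrite (qr_alpha0 traj) gtr_pMr// exprS.
  apply: (@le_lt_trans _ _ gamma1); last by case/andP: gamma1_01.
  by rewrite ler_piMr// ?exprn_ile1// ltW.
have [sk|sk] := boolP (success k).
  have [_ ->] := qr_success traj sk; apply: (lt_le_trans IH).
  have /andP[ak0 akmax] := alpha_bounds k.
  rewrite le_min akmax ler_peMl ?(ltW ak0)// invf_ge1 ?exprn_gt0//.
  by rewrite exprn_ile1 ?(ltW gamma1_gt0).
have [_ ->] := qr_failure traj sk.
rewrite exprS mulrCA ltr_pM2l// ltNge; apply/negP => /ht.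
exact/negP.
Qed.

(** Each success gains back at most c failures, and the stepsize never falls below
    the threshold by more than one failure. *)
Lemma failures_le (t : nat) :
  (forall k, alpha k <= alpha0 * gamma1 ^+ t -> success k) ->
  forall k, (nU k <= t + c * nS k)%N.
Proof.
move=> ht k; have := lt_le_trans
  (_ : alpha0 * gamma1 ^+ t.+1 * gamma1 ^+ (c * nS k) < _) (alpha_upper k).
rewrite ltr_pM2r ?exprn_gt0// => /(_ (alpha_lower ht k)).
rewrite -mulrA ltr_pM2l// -exprD; rewrite leqNgt; apply: contraTN => h.
rewrite -leNgt; apply: ler_wiXn2l => //; rewrite ?ltW//.
Qed.

Lemma f_nonincreasing k : f (x k.+1) <= f (x k).
Proof.
have [sk|sk] := boolP (success k); last by have [->] := qr_failure traj sk.
have [-> _] := qr_success traj sk.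
rewrite -subr_ge0; apply: le_trans sk; rewrite mulr_ge0//.
apply: (@model_decrease_ge0 _ _ _ _ _ _ _ (alpha k)).
- by case/andP: (alpha_bounds k).
- exact: (qr_decrease traj).
Qed.

Section Counting.
Variables (T : pred nat) (N t : nat) (fstar D : R).
Hypothesis fstar_le : forall y, fstar <= f y.
Hypothesis D_gt0 : 0 < D.
Hypothesis small_success : forall k, alpha k <= alpha0 * gamma1 ^+ t -> success k.
Hypothesis true_success : forall k, (k < N)%N -> T k -> success k ->
  D <= f (x k) - f (x k.+1).

Lemma true_successes_le :
  (\sum_(k < N) (T k && success k))%:R <= (f x0 - fstar) / D.
Proof.
rewrite ler_pdivlMr//; apply: (@le_trans _ _ (f x0 - f (x N))); last first.
  by rewrite lerD2l lerN2.
rewrite -(qr_x0 traj).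
have : forall M, (M <= N)%N ->
    (\sum_(k < M) (T k && success k))%:R * D <= f (x 0%N) - f (x M).
  elim=> [|M IH] MN; first by rewrite big_ord0 mul0r subrr.
  rewrite big_ord_recr/= natrD mulrDl.
  have := IH (ltnW MN); have := f_nonincreasing M.
  case: (boolP (T M && success M)) => [/andP[TM sM]|_]; last by rewrite mul0r; lra.
  by have := true_success MN TM sM; rewrite mul1r; lra.
exact.
Qed.

(** A true iteration is a true success or a failure; eliminating the number of
    successes from failures_le bounds the failures by (t + c N) / (1 + c). *)
Lemma true_iterations_le :
  (\sum_(k < N) T k)%:R <=
  c%:R / (c%:R + 1) * N%:R + ((f x0 - fstar) / D + t%:R / (1 + c%:R)).
Proof.
have NE : N = (nS N + nU N)%N.
  rewrite -big_split/= -[LHS]card_ord -sum1_card; apply: eq_bigr => k _.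
  by case: (success _).
have TE : (\sum_(k < N) T k <= \sum_(k < N) (T k && success k) + nU N)%N.
  by rewrite -big_split/= leq_sum// => k _; case: (T k); case: (success k).
have UE : ((1 + c) * nU N <= t + c * N)%N.
  by rewrite [X in (_ <= _ + _ * X)%N]NE mulnDl mul1n mulnDr addnA leq_add2r failures_le.
move: TE UE; rewrite -(ler_nat R) -[(_ * nU N <= _)%N](ler_nat R).
rewrite !(natrD, natrM).
move: (nU N)%:R => U TE UE.
have := true_successes_le; move: (\sum_(k < N) (T k && _))%:R TE => TS TE TSE.
have c1 : 0 < 1 + c%:R :> R by rewrite ltr_pwDl.
have : U <= (t%:R + c%:R * N%:R) / (1 + c%:R).
  by rewrite ler_pdivlMr// mulrC.
rewrite (addrC c%:R 1) mulrDl (mulrAC c%:R) ; lra.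
Qed.

End Counting.
End Trajectory.

(** * Lower tail of the number of successes in dependent trials *)

Section Partition.
Context {R : realType} {dO : measure_display} {Omega : measurableType dO}.
Variable P : probability Omega R.

Local Notation pr A := (fine (P A)).

Lemma fine_probabilityK (A : set Omega) : measurable A -> P A = (pr A)%:E.
Proof. by move=> mA; rewrite fineK// fin_num_measure. Qed.

Lemma fine_probability_ge0 (A : set Omega) : 0 <= pr A.
Proof. by rewrite fine_ge0. Qed.

Lemma fine_probability_le1 (A : set Omega) : measurable A -> pr A <= 1.
Proof. by move=> mA; rewrite -lee_fin -fine_probabilityK// probability_le1. Qed.

Lemma fine_probability_partition (I : finType) (X : Omega -> I) (A : set Omega) :
  measurable A -> (forall i, measurable (A `&` [set w | X w = i])) ->
  pr A = \sum_i pr (A `&` [set w | X w = i]).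
Proof.
move=> mA mX; apply: EFin_inj; rewrite -fine_probabilityK// -sumEFin.
rewrite [RHS](eq_bigr (fun i => P (A `&` [set w | X w = i]))); last first.
  by move=> i _; rewrite fine_probabilityK.
rewrite fsbig_seq ?index_enum_uniq//= -measure_fin_bigcup//; first last.
- by move=> i j _ _ [w [[_ /= <-] [_ /= <-]]].
congr (P _); apply/seteqP; split=> [w Aw|w [i _ []]//].
by exists (X w) => //=; rewrite mem_index_enum.
Qed.

End Partition.

Section CountingTrials.
Context {dO : measure_display} {Omega : measurableType dO}.

Definition count_true (T : nat -> Omega -> bool) k w := (\sum_(i < k) T i w)%N.

Lemma count_true_le T k w : (count_true T k w <= k)%N.
Proof.
by rewrite -[leqRHS]card_ord -sum1_card; apply: leq_sum => i _; case: (T i w).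
Qed.

Lemma count_true_recr T k w : count_true T k.+1 w = (count_true T k w + T k w)%N.
Proof. by rewrite /count_true big_ord_recr. Qed.

Lemma measurable_count_true (T : nat -> Omega -> bool) (k j : nat) :
  (forall i, (i < k)%N -> measurable [set w | T i w]) ->
  measurable [set w | count_true T k w = j].
Proof.
elim: k j => [|k IH] j mT.
  rewrite /count_true; under eq_set do rewrite big_ord0.
  have [->|/eqP j0] := eqVneq j 0%N.
    by rewrite (_ : [set _ | _] = setT)//; apply/seteqP; split.
  by rewrite (_ : [set _ | _] = set0)//; apply/seteqP; split=> // w /= /esym.
have mk i := IH i (fun i ik => mT i (ltnW ik)).
have -> : [set w | count_true T k.+1 w = j]
    = ([set w | count_true T k w = j] `&` ~` [set w | T k w])
      `|` (if j is i.+1 then [set w | count_true T k w = i] `&` [set w | T k w]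
           else set0).
  apply/seteqP; split=> w /=; rewrite count_true_recr.
    by case Tk: (T k w); rewrite ?addn1 ?addn0 => <-; [right|left]; split.
  case=> [[<- /negP/negPf ->]|]; first by rewrite addn0.
  by case: j => // i [<- ->]; rewrite addn1.
apply: measurableU; first by apply: measurableI => //; apply: measurableC; exact: mT.
by case: j => // i; apply: measurableI => //; exact: mT.
Qed.

End CountingTrials.

Section Chernoff.
Context {R : realType} {dO : measure_display} {Omega : measurableType dO}.
Variable P : probability Omega R.

Local Notation pr A := (fine (P A)).

(** The difference of the two sides is non-decreasing, by expR_ge1Dx. *)
Lemma expRN_le_quadratic (t : R) : 0 <= t -> expR (- t) <= 1 - t + t ^+ 2 / 2.
Proof.
move=> t0.
pose g (u : R) := u ^+ 2 * 2^-1 - u - expR (- u).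
pose dg (u : R) := u - 1 + expR (- u).
have gdg (u : R) : is_derive u 1 g (dg u).
  by apply: is_derive_eq; rewrite /dg /GRing.scale/=; lra.
have [|u] := @MVT_segment R g dg 0 t t0 (fun u _ => gdg u).
  by apply: derivable_within_continuous => r _.
rewrite in_itv/= => /andP[u0 _].
have : 0 <= dg u by have := expR_ge1Dx (- u); rewrite /dg; lra.
move=> dg0 gE; have : 0 <= dg u * (t - 0) by rewrite subr0 mulr_ge0.
by rewrite -gE /g oppr0 expR0; lra.
Qed.

Variables (T : nat -> Omega -> bool) (q delta : R) (N : nat).
Hypothesis mT : forall k, measurable [set w | T k w].
Hypothesis q_ge0 : 0 <= q.
Hypothesis delta_ge0 : 0 <= delta.
(* A lower bound given the number of earlier successes replaces independence. *)
Hypothesis trial : forall k j,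
  q * pr [set w | count_true T k w = j]
  <= pr ([set w | count_true T k w = j] `&` [set w | T k w]).

Let mcount k j : measurable [set w | count_true T k w = j].
Proof. exact: measurable_count_true. Qed.

Let mcountT k j :
  measurable ([set w | count_true T k w = j] `&` [set w | T k w]).
Proof. exact: measurableI. Qed.

(** The Laplace transform of the number of successes, E[exp (- delta * count)]. *)
Let laplace k : R :=
  \sum_(j < k.+1) expR (- delta) ^+ j * pr [set w | count_true T k w = j].

(** Trial k sends the mass of the event that the count is j partly to j + 1, which
    multiplies its weight by exp (- delta). *)
Lemma laplace_recr k :
  laplace k.+1 = \sum_(j < k.+1) expR (- delta) ^+ j *
    (pr [set w | count_true T k w = j] - (1 - expR (- delta))
       * pr ([set w | count_true T k w = j] `&` [set w | T k w])).
Proof.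
pose a j := pr [set w | count_true T k w = j].
pose t j := pr ([set w | count_true T k w = j] `&` [set w | T k w]).
have split_count j :
    pr [set w | count_true T k.+1 w = j]
    = (a j - t j) + (if j is i.+1 then t i else 0).
  have mTb (A : set Omega) (b : bool) : measurable A ->
      measurable (A `&` [set w | T k w = b]).
    move=> mA; apply: measurableI => //; case: b; first exact: mT.
    rewrite (_ : [set _ | _] = ~` [set w | T k w]); first exact: measurableC.
    by apply/seteqP; split=> w /=; [move=> /negbT/negP|move=> /negP/negPf].
  have pE (A : set Omega) : measurable A ->
      pr A = pr (A `&` [set w | T k w = true]) + pr (A `&` [set w | T k w = false]).
    move=> mA; rewrite (fine_probability_partition P (X := T k))//.
      by rewrite big_bool.
    by move=> b; exact: mTb.
  rewrite (pE [set w | count_true T k.+1 w = j])//.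
  rewrite /a (pE [set w | count_true T k w = j])//.
  have -> : [set w | count_true T k.+1 w = j] `&` [set w | T k w = false]
     = [set w | count_true T k w = j] `&` [set w | T k w = false].
    by apply/seteqP; split=> w [/= <- Tk];
      rewrite count_true_recr Tk addn0.
  have -> : [set w | count_true T k.+1 w = j] `&` [set w | T k w = true]
     = (if j is i.+1 then [set w | count_true T k w = i] `&` [set w | T k w] else set0).
    apply/seteqP; split=> w.
      by move=> [/= <- Tk]; rewrite count_true_recr Tk addn1; split.
    case: j => [[]|i [/= <- Tk]]; split=> //=; rewrite count_true_recr Tk addn1//.
  rewrite /t; case: j => [|i]; rewrite ?measure0/=; ring.
have t0 : a k.+1 - t k.+1 = 0.
  have e0 : [set w | count_true T k w = k.+1] = set0.
    apply/seteqP; split=> // w /= wk.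
    by have := count_true_le T k w; rewrite wk ltnn.
  by rewrite /a /t e0 set0I measure0/= subrr.
rewrite /laplace; under eq_bigr do rewrite split_count mulrDr.
rewrite big_split/= big_ord_recr/= t0 mulr0 addr0.
rewrite [X in _ + X]big_ord_recl/= mulr0 add0r -big_split/=.
apply: eq_bigr => j _; rewrite -/(a j) -/(t j) exprS; ring.
Qed.

(** One more trial multiplies the transform by at most 1 - (1 - exp (- delta)) q. *)
Lemma laplace_le k : laplace k <= expR (- (1 - expR (- delta)) * q) ^+ k.
Proof.
have z_le1 : expR (- delta) <= 1 by rewrite -expR0 ler_expR oppr_le0.
elim: k => [|k IH].
  rewrite /laplace big_ord1 !expr0 mul1r fine_probability_le1//.
rewrite laplace_recr exprSr.
apply: (@le_trans _ _ (laplace k * (1 - (1 - expR (- delta)) * q))).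
  rewrite mulr_suml; apply: ler_sum => j _.
  rewrite -mulrA ler_wpM2l ?exprn_ge0 ?expR_ge0//.
  have := trial k j; set a := pr _; set t := pr _ => qt.
  have : (1 - expR (- delta)) * (q * a) <= (1 - expR (- delta)) * t.
    by rewrite ler_wpM2l// subr_ge0.
  lra.
have l0 : 0 <= laplace k.
  apply: sumr_ge0 => j _.
  by rewrite mulr_ge0 ?exprn_ge0 ?expR_ge0// fine_probability_ge0.
apply: (@le_trans _ _ (laplace k * expR (- (1 - expR (- delta)) * q))).
  by rewrite ler_wpM2l// -mulNr expR_ge1Dx.
by rewrite ler_wpM2r ?expR_ge0.
Qed.

(** Exponential Markov inequality with parameter delta, together with
    1 - exp (- delta) >= delta - delta ^ 2 / 2. *)
Lemma chernoff_lower_tail :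
  pr [set w | (count_true T N w)%:R < (1 - delta) * q * N%:R]
  <= expR (- (delta ^+ 2 / 2 * q * N%:R)).
Proof.
set m := (1 - delta) * q * N%:R.
pose X w : 'I_N.+1 := inord (count_true T N w).
have XE (j : 'I_N.+1) : [set w | X w = j] = [set w | count_true T N w = j].
  apply/seteqP; split=> w /=; last first.
    by move=> wj; apply/val_inj; rewrite /X/= inordK// wj.
  by move=> <-; rewrite inordK// ltnS count_true_le.
have tailI (j : 'I_N.+1) : [set w | (count_true T N w)%:R < m] `&` [set w | X w = j]
    = if (j%:R : R) < m then [set w | count_true T N w = j] else set0.
  rewrite XE; apply/seteqP; split=> [w [/= + wj]|w]; first by rewrite wj => ->.
  by case: ifP => // jm /= wj; rewrite wj.
have mtail (j : 'I_N.+1) :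
    measurable (if (j%:R : R) < m then [set w | count_true T N w = j] else set0).
  by case: ifP.
have mlt : measurable [set w | (count_true T N w)%:R < m].
  rewrite [X in measurable X](_ : _ = \bigcup_(j in [set: 'I_N.+1])
    (if (j%:R : R) < m then [set w | count_true T N w = j] else set0)).
    by apply: fin_bigcup_measurable.
  apply/seteqP; split=> [w wm|w [j _]]; last first.
    by rewrite -tailI => -[].
  by exists (X w) => //; rewrite -tailI.
rewrite (fine_probability_partition P (X := X))//; last by move=> j; rewrite tailI.
apply: (@le_trans _ _ (expR (delta * m) * laplace N)).
  rewrite mulr_sumr; apply: ler_sum => j _; rewrite tailI.
  case: ifPn => [jm|_]; last first.
    by rewrite measure0 !mulr_ge0 ?exprn_ge0 ?expR_ge0// fine_probability_ge0.
  rewrite mulrA ler_peMl ?fine_probability_ge0//.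
  rewrite -[leLHS]expR0 -expRM_natl -expRD ler_expR mulrN (mulrC j%:R) -mulrBr.
  by rewrite mulr_ge0// subr_ge0 ltW.
apply: (@le_trans _ _ (expR (delta * m) * expR (- (1 - expR (- delta)) * q) ^+ N)).
  by rewrite ler_wpM2l ?expR_ge0// laplace_le.
rewrite -expRM_natl -expRD ler_expR /m.
have qN : 0 <= q * N%:R by rewrite mulr_ge0.
have := ler_wpM2r qN (expRN_le_quadratic delta_ge0); lra.
Qed.

End Chernoff.

(** * True iterations given the past *)

Section Borel.
Context {R : realType}.

Lemma closed_borel (T : topologicalType) (E : set T) : closed E -> borel E.
Proof.
move=> cE; rewrite -(setCK E) -setTD.
have [_ + _] := smallest_sigma_algebra setT [set U : set T | open U].
by apply; apply: sub_sigma_algebra; rewrite /= openC.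
Qed.

Lemma finite_borel m n (E : set 'M[R]_(m, n)) : finite_set E -> borel E.
Proof.
move=> fE; apply: closed_borel; apply: (accessible_finite_set_closed.1 _) fE.
exact/hausdorff_accessible/norm_hausdorff.
Qed.

Lemma continuous_norm2_sqr (T : topologicalType) m n (A : 'M[R]_(m, n))
    (u : T -> 'cV[R]_n) :
  continuous u -> continuous (fun y => norm2 (A *m u y) ^+ 2).
Proof.
move=> cu.
have cAu i : continuous (fun y => (A *m u y) i 0).
  rewrite (_ : (fun y => _) = fun y => \sum_j A i j * u y j 0); last first.
    by apply/funext => y; rewrite mxE.
  apply: continuous_big => [|j _ y]; first exact: add_continuous.
  apply: continuousM; first exact: cst_continuous.
  apply: (@continuous_comp _ _ _ u (fun M : 'cV[R]_n => M j 0)); first exact: cu.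
  exact: coord_continuous.
rewrite (_ : (fun y => _) = fun y => \sum_i (A *m u y) i 0 * (A *m u y) i 0); last first.
  by apply/funext => y; rewrite norm2_sqr.
apply: continuous_big => [|i _ y]; first exact: add_continuous.
by apply: continuousM; exact: cAu.
Qed.

End Borel.

Section ConditionalSuccess.
Context {R : realType} {dO : measure_display} {Omega : measurableType dO}.
Variable P : probability Omega R.
Local Notation pr A := (fine (P A)).

(** Conditioning on the value of a finite-valued function known in advance turns a
    test that depends on this value into a test of the independent draw alone. *)
Lemma independent_draw_success (G : set (set Omega)) (U : Type) (I : finType)
    (X : Omega -> I) (Y : Omega -> U) (E : I -> set U) (q : R) (A : set Omega) :
  <<s G >> `<=` measurable ->
  (forall i, measurable (Y @^-1` E i)) ->
  (forall i, <<s G >> [set w | X w = i]) ->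
  (forall i B, <<s G >> B -> P (B `&` Y @^-1` E i) = (P B * P (Y @^-1` E i))%E) ->
  (forall w, q <= pr (Y @^-1` E (X w))) ->
  <<s G >> A ->
  q * pr A <= pr (A `&` [set w | E (X w) (Y w)]).
Proof.
move=> Gm mE mX indep qE GA; have mA := Gm _ GA.
have GAX i : <<s G >> (A `&` [set w | X w = i]).
  by have := @measurableI _ (g_sigma_algebraType G) A _ GA (mX i).
have slice i : (A `&` [set w | E (X w) (Y w)]) `&` [set w | X w = i]
    = (A `&` [set w | X w = i]) `&` Y @^-1` E i.
  by apply/seteqP; split=> w; [move=> [[Aw /= Ew] /= <-]|move=> [[Aw /= <-] Ew]].
have mslice i : measurable ((A `&` [set w | X w = i]) `&` Y @^-1` E i).
  by apply: measurableI => //; exact: Gm.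
have mS : measurable (A `&` [set w | E (X w) (Y w)]).
  rewrite [X in measurable X](_ : _ = \bigcup_(i in [set: I])
      ((A `&` [set w | X w = i]) `&` Y @^-1` E i)); first exact: fin_bigcup_measurable.
  apply/seteqP; split=> [w [Aw Ew]|w [i _ [[Aw Xi] Ei]]]; first by exists (X w).
  by split=> //; rewrite /= Xi.
rewrite (fine_probability_partition P (X := X) mA); last by move=> i; exact: Gm.
rewrite (fine_probability_partition P (X := X) mS); last by move=> i; rewrite slice.
rewrite mulr_sumr; apply: ler_sum => i _; rewrite slice indep//.
rewrite fineM ?fin_num_measure//; last exact: Gm.
rewrite mulrC; have [->|/set0P[w [_ /= <-]]] := eqVneq (A `&` [set w | X w = i]) set0.
  by rewrite measure0 !mul0r.
by rewrite ler_wpM2l// fine_ge0.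
Qed.

End ConditionalSuccess.

Section TrueIterations.
Context {R : realType} {dO : measure_display} {Omega : measurableType dO}.
Variables (P : probability Omega R) (l d : nat) (f : 'cV[R]_d -> R).
Variables (gamma1 theta alphamax kappaT : R) (c p : nat) (x0 : 'cV[R]_d).
Variables (S : nat -> Omega -> 'M[R]_(l, d)) (B : nat -> Omega -> 'M[R]_d).
Variables (s : nat -> Omega -> 'cV[R]_l) (x : nat -> Omega -> 'cV[R]_d).
Variable alpha : nat -> Omega -> R.
Hypothesis run : random_qr_run P f gamma1 theta alphamax kappaT c p x0 S B s x alpha.
Variables (epsS q : R).
Hypothesis grad_cont : continuous (grad f).
Hypothesis embed : forall y, q <= stable_1_hashing
  [set M : 'M[R]_(l, d) | norm2 (M *m grad f y) ^+ 2
                          >= (1 - epsS) * norm2 (grad f y) ^+ 2].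

(** This finite-valued function of the iterate carries all that one needs to know of it
    to decide whether an iteration is true. *)
Definition good_seeds (y : 'cV[R]_d) : {set hash_seed l d} :=
  [set w : hash_seed l d | injectiveb w.1
     && ((1 - epsS) * norm2 (grad f y) ^+ 2 <= norm2 (hash_mx w *m grad f y) ^+ 2)].

Definition sketches (Q : {set hash_seed l d}) : set 'M[R]_(l, d) :=
  [set hash_mx w | w in [set w | w \in Q]].

(** Asking for the matrix of a good seed, and not only for a good sketch, also
    controls the norm of S_k. *)
Definition true_iteration k (w : Omega) : bool :=
  `[< sketches (good_seeds (x k w)) (S k w) >].

Lemma borel_sketches Q : borel (sketches Q).
Proof. by apply: finite_borel; apply: finite_image; exact: finite_finset. Qed.

Lemma history_sub_measurable k : history S B s x alpha k `<=` measurable.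
Proof.
apply: smallest_sub; first exact: sigma_algebra_measurable.
move=> A [[[[|]|]|]|] [i _ [E bE ->]].
- exact: (run_x run).
- exact: (run_alpha run).
- exact: (run_S run).
- exact: (run_B run).
- exact: (run_s run).
Qed.

Lemma history_x k i E : (i <= k)%N -> borel E ->
  history S B s x alpha k (x i @^-1` E).
Proof.
by move=> ik bE; apply: sub_sigma_algebra; do 4 left; exists i => //; exists E.
Qed.

Lemma history_S k i E : (i < k)%N -> borel E ->
  history S B s x alpha k (S i @^-1` E).
Proof.
by move=> ik bE; apply: sub_sigma_algebra; do 2 left; right; exists i => //; exists E.
Qed.

Lemma history_good_seeds k i Q : (i <= k)%N ->
  history S B s x alpha k [set w | good_seeds (x i w) = Q].
Proof.
move=> ik; rewrite /history; set G := (X in <<s X >>).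
pose F (v : hash_seed l d) : set 'cV[R]_d := [set y | v \in good_seeds y].
have mF v : <<s G >> (x i @^-1` F v).
  apply: history_x => //; apply: closed_borel.
  rewrite /F; under eq_set do rewrite inE.
  have [_|_] := boolP (injectiveb v.1); last first.
    rewrite (_ : [set _ | _] = set0); first exact: closed0.
    by apply/seteqP; split.
  pose g y := norm2 (hash_mx v *m grad f y) ^+ 2
    - (1 - epsS) * norm2 (1%:M *m grad f y) ^+ 2.
  have cg : continuous g.
    move=> y; apply: (@cvgB _ _ _ (nbhs y)); first exact: continuous_norm2_sqr.
    apply: cvgM; first exact: cvg_cst.
    exact: continuous_norm2_sqr.
  rewrite (_ : [set _ | _] = g @^-1` [set r | 0 <= r]).
    exact: ((continuous_closedP g).1 cg _ (@closed_ge R 0)).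
  by apply/seteqP; split=> y /=; rewrite /g mul1mx subr_ge0.
have -> : [set w | good_seeds (x i w) = Q]
    = \bigcap_(v in [set: hash_seed l d])
        (if v \in Q then x i @^-1` F v else ~` (x i @^-1` F v)).
  apply/seteqP; split=> [w /= <- v _|w wQ].
    by case: ifPn => // /negP.
  apply/setP => v; have := wQ v I; rewrite /F.
  by case: ifP => _ //= /negP/negPf.
apply: (@fin_bigcap_measurable _ (g_sigma_algebraType G)) => [|v _].
  exact: finite_finset.
case: ifP => _; first exact: mF.
apply: (@measurableC _ (g_sigma_algebraType G)); exact: mF.
Qed.

Lemma history_true_iteration k i : (i < k)%N ->
  history S B s x alpha k [set w | true_iteration i w].
Proof.
move=> ik; rewrite /history; set G := (X in <<s X >>).
have -> : [set w | true_iteration i w]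
    = \bigcup_(Q in [set: {set hash_seed l d}])
       ([set w | good_seeds (x i w) = Q] `&` S i @^-1` sketches Q).
  apply/seteqP; split=> [w /asboolP Sw|w [Q _ [/= <- Sw]]].
    by exists (good_seeds (x i w)).
  exact/asboolP.
apply: (@fin_bigcup_measurable _ (g_sigma_algebraType G)) => [|Q _].
  exact: finite_finset.
apply: (@measurableI _ (g_sigma_algebraType G)).
  by apply: history_good_seeds; exact: ltnW.
by apply: history_S => //; exact: borel_sketches.
Qed.

Lemma measurable_true_iteration k : measurable [set w | true_iteration k w].
Proof.
by apply: (@history_sub_measurable k.+1); apply: history_true_iteration.
Qed.

(** The law of the hashing matrix only charges matrices of injective seeds. *)
Lemma stable_1_hashing_good_seeds y : q <= stable_1_hashing (sketches (good_seeds y)).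
Proof.
apply: (le_trans (embed y)); rewrite ler_wpM2r ?invr_ge0// ler_nat.
apply: subset_leq_card; apply/fintype.subsetP => w.
rewrite !inE => /andP[winj /asboolP ew].
by rewrite winj; apply/asboolP; exists w => //=; rewrite inE winj.
Qed.

Lemma true_iteration_probability k j :
  q * fine (P [set w | count_true true_iteration k w = j])
  <= fine (P ([set w | count_true true_iteration k w = j]
              `&` [set w | true_iteration k w])).
Proof.
have -> : [set w | true_iteration k w]
    = [set w | sketches (good_seeds (x k w)) (S k w)].
  by apply/seteqP; split=> w /= /asboolP.
apply: (independent_draw_success (X := fun w => good_seeds (x k w)) (E := sketches)).
- exact: (@history_sub_measurable k).
- by move=> Q; apply: (run_S run); exact: borel_sketches.
- by move=> Q; apply: history_good_seeds.
- by move=> Q A hA; apply: (run_indep run) => //; exact: borel_sketches.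
- move=> w; rewrite (run_law run) /=; first exact: stable_1_hashing_good_seeds.
  exact: borel_sketches.
- apply: (@measurable_count_true _ (g_sigma_algebraType _)) => i ik.
  exact: history_true_iteration.
Qed.

Lemma true_iterationP k w : true_iteration k w ->
  (forall v, norm2 (S k w *m v) <= Num.sqrt (ceil_div d l)%:R * norm2 v) /\
  (1 - epsS) * norm2 (grad f (x k w)) ^+ 2 <= norm2 (S k w *m grad f (x k w)) ^+ 2.
Proof.
move=> /asboolP[u /=]; rewrite inE => /andP[/injectiveP uinj ug] <-; split=> //.
by move=> v; exact: norm2_hash_mx.
Qed.

End TrueIterations.

(** * Constants and the hitting time *)

Section Assembly.
Context {R : realType}.

(** The infimum defining N_eps ranges over integers, so it is at most N as soon as it
    is below N + 1. *)
Lemma N_eps_leP d (f : 'cV[R]_d -> R) (eps : R) (x : nat -> 'cV[R]_d) (N : nat) :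
  reflect (exists2 k, (k <= N)%N & norm2 (grad f (x k)) <= eps)
          (N_eps f eps x <= N%:R%:E)%E.
Proof.
apply: (iffP idP) => [NN|[k kN kx]].
  have : (N_eps f eps x < N.+1%:R%:E)%E.
    by apply: (le_lt_trans NN); rewrite lte_fin ltr_nat.
  move=> /ereal_inf_lt[_ [M /bigmin_leP Mmin <-]]; rewrite lte_fin ltr_nat ltnS => MN.
  case: Mmin => [|[i _ ix]]; first by exists 0%N.
  by exists i => //; apply: leq_trans MN; rewrite -ltnS.
apply: (@le_trans _ _ k%:R%:E); last by rewrite lee_fin ler_nat.
apply: ereal_inf_lbound; exists k => //=; apply/bigmin_leP; right.
by exists ord_max.
Qed.

Lemma lipschitz_gradient_ge0 d (f : 'cV[R]_d -> R) (L : R) :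
  (0 < d)%N -> lipschitz_gradient f L -> 0 <= L.
Proof.
move=> d0 /(_ (delta_mx (Ordinal d0) 0) 0); set u := delta_mx _ _.
rewrite subr0 => /(le_trans (norm2_ge0 _)).
have -> : norm2 u = 1 by rewrite /norm2 dot_delta mxE !eqxx sqrtr1.
by rewrite mulr1.
Qed.

(** When L + Bmax = 0 the quotient alpha_low is 0 by convention, and then the
    exponent is 0. *)
Lemma tau_alphaP (gamma1 theta L Bmax alpha0 : R) (c : nat) :
  0 < gamma1 < 1 -> theta < 1 -> 0 < alpha0 ->
  exists2 t : nat, tau_alpha gamma1 theta L Bmax alpha0 c = t &
    0 < L + Bmax -> alpha0 * gamma1 ^+ t <= alpha_low theta L Bmax.
Proof.
move=> /andP[g0 g1] theta1 alpha00; rewrite /tau_alpha.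
set m := Num.min _ _.
have lng : ln gamma1 < 0 by rewrite ln_lt0// g0.
have m1 : m <= 1.
  rewrite /m ge_min; apply/orP; right.
  by rewrite div1r invrK exprn_ile1// ltW.
have r0 : 0 <= ln m / ln gamma1 by rewrite ler_ndivlMr// mul0r ln_le0.
have := ceil_ge (ln m / ln gamma1).
have : 0 <= Num.ceil (ln m / ln gamma1) by rewrite ceil_ge0 (lt_le_trans _ r0)// ltrN10.
case: (Num.ceil _) => // t _ ht; exists t => // LB.
have m0 : 0 < m.
  by rewrite lt_min div1r invrK exprn_gt0// andbT !divr_gt0// subr_gt0.
have : gamma1 ^+ t <= m.
  rewrite -ler_ln ?posrE ?exprn_gt0// lnXn// -mulr_natl.
  by move: ht; rewrite ler_ndivrMr.
have mlow : m <= alpha_low theta L Bmax / alpha0 by rewrite ge_min lexx.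
by move=> /le_trans/(_ mlow); rewrite ler_pdivlMr// mulrC.
Qed.

Lemma h_gt0 l d (theta epsS alphamax Bmax kappaT eps a : R) :
  (0 < ceil_div d l)%N -> 0 < theta -> epsS < 1 -> 0 < alphamax ->
  0 <= Bmax -> 0 <= kappaT -> 0 < eps -> 0 < a ->
  0 < h l d theta epsS alphamax Bmax kappaT eps a.
Proof.
move=> cd0 theta0 epsS1 am0 B0 k0 eps0 a0; rewrite /h.
rewrite mulr_gt0 ?divr_gt0 ?mulr_gt0 ?exprn_gt0 ?subr_gt0// invr_gt0 exprn_gt0//.
by rewrite ltr_wpDr// mulr_gt0 ?sqrtr_gt0 ?ltr0n// ltr_wpDl// invr_gt0.
Qed.

Lemma ceil_div_gt0 l d : (0 < l)%N -> (0 < d)%N -> (0 < ceil_div d l)%N.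
Proof.
move=> l0 d0; rewrite /ceil_div absz_gt0 gt_eqF// ceil_gt0.
by rewrite divr_gt0 ?ltr0n.
Qed.

End Assembly.

(** * The high-probability complexity bound *)

Theorem theorem4p2
  (R : realType) (l d : nat) (hl : (0 < l)%N) (hld : (l < d)%N)
  (f : 'cV[R]_d -> R) (L fstar : R)
  (hf : continuously_differentiable f) (hL : lipschitz_gradient f L)
  (hfstar : (exists x, f x = fstar) /\ forall x, fstar <= f x)
  (C3 epsS delta1 : R)
  (hC3 : 0 < C3) (hemb : embedding_constant f l epsS C3)
  (hdelta1 : 0 < delta1) (hepsS : 0 < epsS < 3 / 4)
  (gamma1 theta alphamax kappaT Bmax : R) (c p : nat) (x0 : 'cV[R]_d)
  (hgamma1 : 0 < gamma1 < 1) (hc : (0 < c)%N) (hp : (0 < p)%N)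
  (htheta : 0 < theta < 1) (halphamax : 0 < alphamax)
  (hkappaT : 0 <= kappaT) (hBmax : 0 <= Bmax)
  (deltaS := delta_S l epsS C3)
  (rate := (1 - deltaS) * (1 - delta1) - 1 + c%:R / (c%:R + 1) ^+ 2)
  (hdeltaS : deltaS < c%:R / (c%:R + 1) ^+ 2) (hrate : 0 < rate^-1)
  (dO : measure_display) (Omega : measurableType dO)
  (P : probability Omega R)
  (S : nat -> Omega -> 'M[R]_(l, d)) (B : nat -> Omega -> 'M[R]_d)
  (s : nat -> Omega -> 'cV[R]_l) (x : nat -> Omega -> 'cV[R]_d)
  (alpha : nat -> Omega -> R)
  (hrun : random_qr_run P f gamma1 theta alphamax kappaT c p x0 S B s x alpha)
  (hB : forall k w, spectral_norm (B k w) <= Bmax)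
  (eps : R) (heps : 0 < eps)
  (alpha0 := alphamax * gamma1 ^+ p)
  (tau := tau_alpha gamma1 theta L Bmax alpha0 c)
  (N : nat)
  (hN : rate^-1 *
        ((f x0 - fstar)
           / h l d theta epsS alphamax Bmax kappaT eps
               (alpha0 * gamma1 ^ (c%:Z + tau))
         + tau%:~R / (1 + c%:R))
        <= N%:R) :
  ((1 - expR (- (delta1 ^+ 2 / 2 * (1 - deltaS) * N%:R)))%:E
   <= P [set w | (N_eps f eps (x ^~ w) <= (N%:R)%:E)%E])%E.
Proof.
have [gamma10 gamma1_1] := andP hgamma1.
have [theta0 theta1] := andP htheta.
have [epsS0 epsS34] := andP hepsS.
have d0 : (0 < d)%N by exact: leq_ltn_trans hld.
have epsS1 : epsS < 1 by lra.
have c0 : 0 <= c%:R :> R by [].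
have rate0 : 0 < rate by rewrite -invr_gt0.
have alpha00 : 0 < alpha0 by rewrite mulr_gt0// exprn_gt0.
have deltaS0 : 0 < deltaS by exact: expR_gt0.
have deltaS4 : deltaS < 4^-1.
  apply: (lt_le_trans hdeltaS); rewrite ler_pdivrMr ?exprn_gt0 ?ltr_wpDl//.
  by have := sqr_ge0 (c%:R - 1 : R); lra.
have embed y : 1 - deltaS <= stable_1_hashing
    [set M : 'M[R]_(l, d) | norm2 (M *m grad f y) ^+ 2
                            >= (1 - epsS) * norm2 (grad f y) ^+ 2].
  by apply: hemb; rewrite deltaS0/= (lt_trans deltaS4)// ltf_pV2 ?posrE// ltr_nat.
have L0 := lipschitz_gradient_ge0 d0 hL.
have [t tauE talpha] := tau_alphaP L Bmax c hgamma1 theta1 alpha00.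
have cd0 := ceil_div_gt0 hl d0.
pose T := true_iteration f S x epsS.
pose hit := [set w | exists2 k, (k <= N)%N & norm2 (grad f (x k w)) <= eps].
rewrite (_ : [set w | _] = hit); last first.
  by apply/seteqP; split=> w /N_eps_leP.
have mhit : measurable hit.
  rewrite [X in measurable X](_ : _ = \bigcup_(k in [set k | (k <= N)%N])
     (x k @^-1` [set y | norm2 (1%:M *m grad f y) ^+ 2 <= eps ^+ 2])).
    apply: bigcup_measurable => k _; apply: (run_x hrun); apply: closed_borel.
    have cg := continuous_norm2_sqr (A := 1%:M) hf.2.
    exact: ((continuous_closedP _).1 cg _ (@closed_le R (eps ^+ 2))).
  have sqrE y : (norm2 (1%:M *m grad f y) ^+ 2 <= eps ^+ 2) = (norm2 (grad f y) <= eps).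
    by rewrite mul1mx ler_pXn2r ?nnegrE ?norm2_ge0// ltW.
  by apply/seteqP; split=> w [k kN kx]; exists k => //; move: kx; rewrite /= sqrE.
have [N0|N0] := posnP N.
  by rewrite N0 mulr0 oppr0 expR0 subrr measure_ge0.
pose few := [set w | (count_true T N w)%:R < (1 - delta1) * (1 - deltaS) * N%:R].
have mT k : measurable [set w | T k w].
  exact: (measurable_true_iteration hrun _ hf.2).
have mfew : measurable few.
  rewrite [X in measurable X](_ : _ = \bigcup_(j in
      [set j | j%:R < (1 - delta1) * (1 - deltaS) * N%:R])
      [set w | count_true T N w = j]); last first.
    by apply/seteqP; split=> w; [exists (count_true T N w)|case=> j /= + wj; rewrite -wj].
  by apply: bigcup_measurable => j _; apply: measurable_count_true.
have Pfew : fine (P few) <= expR (- (delta1 ^+ 2 / 2 * (1 - deltaS) * N%:R)).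
  apply: chernoff_lower_tail => //.
  - by rewrite subr_ge0; lra.
  - exact: ltW.
  - move=> k j; exact: (true_iteration_probability hrun hf.2 embed).
suff sub : ~` few `<=` hit.
  apply: (@le_trans _ _ (P (~` few))).
    by rewrite probability_setC// (fine_probabilityK P mfew) -EFinB lee_fin lerD2l lerN2.
  by apply: le_measure; rewrite ?inE//; exact: measurableC.
move=> w /negP; rewrite -leNgt => many; apply: contrapT => nohit.
have gradeps k : (k < N)%N -> eps <= norm2 (grad f (x k w)).
  move=> kN; rewrite leNgt; apply/negP => /ltW kx.
  by apply: nohit; exists k => //; exact: ltnW.
have traj := run_trajectory hrun w.
have small k : alpha k w <= alpha0 * gamma1 ^+ t ->
    sufficient_decrease f theta (x k w) (S k w) (B k w) (s k w).
  move=> akt; have /andP[ak0 _] := alpha_bounds traj hgamma1 halphamax k.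
  apply: (small_alpha_success ak0 (qr_psd traj k) (qr_decrease traj k) htheta hf.1 hL).
  have [LB0|LB0] := ltP 0 (L + Bmax); last first.
    by have -> : L = 0; [lra|rewrite mul0r; lra].
  have := le_trans akt (talpha LB0); rewrite /alpha_low ler_pdivlMr//.
  by have := mulr_ge0 (ltW ak0) hBmax; lra.
move: hN; rewrite /tau tauE -PoszD -exprnP; set a := alpha0 * gamma1 ^+ (c + t).
have a0 : 0 < a by rewrite mulr_gt0// exprn_gt0.
set D := h _ _ _ _ _ _ _ _ _ => hN.
have D0 : 0 < D by apply: h_gt0.
have progress k : (k < N)%N -> T k w ->
    sufficient_decrease f theta (x k w) (S k w) (B k w) (s k w) ->
    D <= f (x k w) - f (x k.+1 w).
  move=> kN /true_iterationP[Sle Strue] sk; have [-> _] := qr_success traj sk.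
  have /andP[ak0 akm] := alpha_bounds traj hgamma1 halphamax k.
  apply: (true_success_decrease ak0 (qr_psd traj k) (qr_decrease traj k) (hB k w)
    cd0 Sle (qr_stationary traj k)) => //; [exact: ltW| |exact: gradeps].
  apply: (le_trans _ (ltW (alpha_lower traj hgamma1 halphamax small k))).
  rewrite ler_pM2l// ler_wiXn2l ?ltW// -[t.+1]add1n leq_add2r//.
have := true_iterations_le traj hgamma1 (ltW theta0) halphamax hfstar.2 D0 small progress.
move=> /(le_trans many).
(* The margin between the two counts is N / (c + 1) ^ 2 > 0. *)
move: hN; rewrite mulrC ler_pdivrMr// -pmulrn /rate.
have Ngt0 : 0 < N%:R :> R by rewrite ltr0n.
have c1 : 0 < (c%:R + 1) ^-2 :> R by rewrite invr_gt0 exprn_gt0// ltr_wpDl.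
have slack : c%:R / (c%:R + 1) + c%:R / (c%:R + 1) ^+ 2 = 1 - (c%:R + 1) ^-2 :> R.
  by field; rewrite gt_eqF// ltr_wpDl.
have := mulr_gt0 c1 Ngt0.
move: (_ / D + _) => X.
have -> : c%:R / (c%:R + 1) = 1 - (c%:R + 1) ^-2 - c%:R / (c%:R + 1) ^+ 2 :> R by lra.
lra.
Qed.
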